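(* Let $L$ be a finite-dimensional monolithic Leibniz algebra over a field $F$. Then $L$ is a strongly solvable $A$-algebra if and only if $L=L^2\dot{+}B$ is metabelian, where $B$ is a subalgebra of $L$ and $[L^2,b]=L^2$ for all nonzero $b\in B$ (or, equivalently, $R_b$ acts invertibly on $L^2$ for all nonzero $b\in B$).
   Context: A (right) Leibniz algebra over $F$ is a vector space with a bilinear product $[\,,]$ satisfying $[x,[y,z]]=[[x,y],z]-[[x,z],y]$ for all $x,y,z$. Ideals are two-sided. $L^1=L$, $L^{k+1}=[L^k,L]$, so $L^2=[L,L]$; $L$ is nilpotent if $L^k=0$ for some $k$. $L$ is abelian if $[x,y]=0$ for all $x,y$; $L$ is metabelian if $L^2$ is abelian, i.e. $[L^2,L^2]=0$. $L$ is an $A$-algebra if every nilpotent subalgebra of $L$ is abelian. $L$ is strongly solvable (also called completely solvable) if $L^2$ is nilpotent. $L$ is monolithic if it has a unique minimal ideal. $R_b:L\to L$ is right multiplication $y\mapsto[y,b]$. $\dot{+}$ denotes a vector space direct sum. *)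

(* Defs.v *)
From HB Require Import structures.
From mathcomp Require Import all_boot all_algebra.

Set Implicit Arguments.
Unset Strict Implicit.
Unset Printing Implicit Defensive.

Import GRing.Theory.
Local Open Scope ring_scope.

(* Finite-dimensional right Leibniz algebras: since the base structure is
   vectType, finite dimension is built in. *)
HB.mixin Record Vector_isLeibniz (F : fieldType) L of Vector F L := {
  lbr : {bilinear L -> L -> L};
  lbr_leibniz : forall x y z : L,
    lbr x (lbr y z) = lbr (lbr x y) z - lbr (lbr x z) y
}.

#[short(type="leibnizAlgType")]
HB.structure Definition Leibniz (F : fieldType) :=
  {L of Vector F L & Vector_isLeibniz F L}.

Section LeibnizDefs.
Variables (F : fieldType) (L : leibnizAlgType F).
Implicit Types (x y b : L) (U V W B : {vspace L}).

(* R_b; [rmul b @: U] is [U, b]. *)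
Definition rmul b : 'End(L) := linfun (applyr lbr b).

Lemma rmulE b y : rmul b y = lbr y b.
Proof. by rewrite lfunE. Qed.

(* [U, V], the linear span of all brackets: by bilinearity it is enough to
   take brackets of basis vectors (see memv_lprod and lprod_subP). *)
Definition lprod U V : {vspace L} :=
  <<[seq lbr u v | u <- vbasis U, v <- vbasis V]>>%VS.

Lemma memv_lprod U V u v : u \in U -> v \in V -> lbr u v \in lprod U V.
Proof.
move=> /coord_vbasis-> /coord_vbasis->.
rewrite linear_sumlz; apply: memv_suml => i _.
rewrite linearZl_LR; apply: memvZ.
rewrite linear_sumr; apply: memv_suml => j _.
rewrite linearZr_LR; apply: memvZ; apply: memv_span.
by apply: allpairs_f; rewrite memt_nth.
Qed.

Lemma lprod_subP U V W :
  reflect {in U & V, forall u v, lbr u v \in W} (lprod U V <= W)%VS.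
Proof.
apply: (iffP idP) => [sUVW u v Uu Vv | sUVW].
  exact: subvP sUVW _ (memv_lprod Uu Vv).
apply/span_subvP => _ /allpairsP[[u v] /= [/vbasis_mem Uu /vbasis_mem Vv ->]].
exact: sUVW.
Qed.

Definition subalgebra U : Prop := (lprod U U <= U)%VS.

Definition ideal U : Prop :=
  (lprod U fullv <= U)%VS /\ (lprod fullv U <= U)%VS.

(* The power U^k, i.e. U^1 = U and U^(k+1) = [U^k, U]; the index k = 0 is not
   meaningful, and U^0 is U as well. *)
Definition lpow U (k : nat) : {vspace L} := iter k.-1 (fun V => lprod V U) U.

Definition nilpotent U : Prop := exists k, lpow U k = 0%VS.

Definition abelian U : Prop := {in U &, forall x y, lbr x y = 0}.

Definition minimal_ideal W : Prop :=
  [/\ ideal W, W <> 0%VS &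
      forall I : {vspace L}, ideal I -> (I <= W)%VS -> I = 0%VS \/ I = W].

(* f induces an invertible linear endomorphism of U. *)
Definition acts_invertibly (f : 'End(L)) U : Prop :=
  (f @: U <= U)%VS /\
  exists g : 'End(L),
    [/\ (g @: U <= U)%VS, {in U, cancel f g} & {in U, cancel g f}].

End LeibnizDefs.

Section LeibnizAlgebras.
Variables (F : fieldType) (L : leibnizAlgType F).

Definition derived : {vspace L} := lpow fullv 2.

Definition metabelian : Prop := abelian derived.

Definition A_algebra : Prop :=
  forall U : {vspace L}, subalgebra U -> nilpotent U -> abelian U.

Definition strongly_solvable : Prop := nilpotent derived.

Definition monolithic : Prop := exists! W : {vspace L}, minimal_ideal W.

Definition splits_over_derived (B : {vspace L}) : Prop :=
  [/\ subalgebra B, (derived + B = fullv)%VS & (derived :&: B = 0)%VS].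

End LeibnizAlgebras.

Arguments derived {F} L.
Arguments metabelian {F} L.
Arguments A_algebra {F} L.
Arguments strongly_solvable {F} L.
Arguments monolithic {F} L.

(* Main.v *)
(** Strong solvability together with the A-property makes L^2 abelian.  Choose a
    subalgebra H minimal subject to L^2 + H = L.  Right multiplications are
    derivations, so the Fitting null component of R_x on H is a subalgebra; by
    minimality it is all of H, for every x in H.  Hence <x> + (H :&: L^2) is
    nilpotent, thus abelian, for every x in H; this makes H nilpotent, thus
    abelian, and by minimality again H :&: L^2 = 0, so that B := H splits L.
    Since L^2 is abelian, left and right multiplications by arbitrary elements
    commute with R_b on L^2, so both Fitting components of R_b on L^2 are
    ideals and, L being monolithic, one of them vanishes.  If R_b is nilpotent
    on L^2 then <b> + L^2 is nilpotent, thus abelian, so b is central; the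
    ideals <b> and L^2 meet trivially, and monolithicity forces L^2 = 0.
    Conversely, if a nilpotent subalgebra U contains d + b with d in L^2 and
    b != 0 in B, then R_(d+b) = R_b is injective on L^2 and nilpotent on U, so
    [U, U] is contained in U :&: L^2 = 0. *)

Require Import Defs.
From mathcomp Require Import all_boot all_algebra.
From Stdlib Require Import Classical.

Set Implicit Arguments.
Unset Strict Implicit.
Unset Printing Implicit Defensive.

Import GRing.Theory.
Local Open Scope ring_scope.

(** * Minimal subspaces and the Fitting decomposition *)

Section Fitting.
Variables (F : fieldType) (V : vectType F).
Implicit Types (f : 'End(V)) (U W : {vspace V}).

(** Descent on the dimension; as [P] is an arbitrary proposition, excluded middle decides whether a
    smaller subspace remains. *)
Lemma ex_minimal_vspace (P : {vspace V} -> Prop) U : P U ->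
  exists W, [/\ P W, (W <= U)%VS & forall X, P X -> (X <= W)%VS -> X = W].
Proof.
have [n] := ubnP (\dim U); elim: n U => // n IHn U leUn PU.
have [[X [PX sXU neXU]]|minU] :=
  classic (exists X, [/\ P X, (X <= U)%VS & X <> U]).
  have ltXU : (\dim X < \dim U)%N.
    rewrite ltn_neqAle dimvS // andbT; apply/eqP=> eqd.
    by apply: neXU; apply/eqP; rewrite eqEdim sXU eqd /=.
  have [W [PW sWX minW]] := IHn X (leq_trans ltXU leUn) PX.
  by exists W; split=> //; apply: subv_trans sXU.
exists U; split=> // X PX sXU; apply: NNPP => neXU.
by apply: minU; exists X.
Qed.

Lemma lker_cap_eq0 f U : (f @: U)%VS = U -> (U :&: lker f)%VS = 0%VS.
Proof.
move=> fU; apply/eqP; rewrite -dimv_eq0 -(eqn_add2r (\dim (f @: U))).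
by rewrite limg_ker_dim fU.
Qed.

Definition lfun_iter f n : 'End(V) := iter n (comp_lfun f) \1%VF.

Lemma lfun_iterE f n v : lfun_iter f n v = iter n f v.
Proof. by elim: n => [|n IHn] /=; rewrite ?id_lfunE // comp_lfunE IHn. Qed.

Lemma iter_lfunD f n u v : iter n f (u + v) = iter n f u + iter n f v.
Proof. by rewrite -!lfun_iterE linearD. Qed.

Lemma iter_lfun0 f n : iter n f 0 = 0.
Proof. by rewrite -lfun_iterE linear0. Qed.

Lemma limg_lfun_iterS f n U :
  (lfun_iter f n.+1 @: U)%VS = (f @: (lfun_iter f n @: U))%VS.
Proof. by rewrite -limg_comp. Qed.

Lemma limg_lfun_iter_sub f n U :
  (f @: U <= U)%VS -> (lfun_iter f n @: U <= U)%VS.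
Proof.
move=> fU; elim: n => [|n IHn]; first by rewrite lim1g.
by rewrite limg_lfun_iterS (subv_trans _ fU) // limgS.
Qed.

Lemma limg_lfun_iter_stable f U : (f @: U <= U)%VS ->
  exists n, (f @: (lfun_iter f n @: U))%VS = (lfun_iter f n @: U)%VS.
Proof.
move=> fU; pose P W := exists n, W = (lfun_iter f n @: U)%VS.
have [|_ [[n ->] _ minW]] := @ex_minimal_vspace P U.
  by exists 0; rewrite lim1g.
exists n; apply: minW; first by exists n.+1; rewrite limg_lfun_iterS.
elim: n => [|n IHn]; first by rewrite lim1g.
by rewrite limg_lfun_iterS limgS.
Qed.

Lemma iter_lfun_inj f U : (f @: U)%VS = U ->
  forall n v, v \in U -> iter n f v = 0 -> v = 0.
Proof.
move=> fU; elim=> [|n IHn] v Uv //; rewrite iterSr => fv0.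
have fv : f v = 0 by apply: IHn fv0; rewrite -fU memv_img.
by apply/eqP; rewrite -memv0 -(lker_cap_eq0 fU) memv_cap Uv memv_ker fv /=.
Qed.

(** [n] is chosen where the images [f^n U] stabilise: [f] is then injective on [M], and rank-nullity
    gives the sum. The last clause says that [N] absorbs the kernels on [U] of all powers of [f],
    whatever the exponent. *)
Lemma fitting f U : (f @: U <= U)%VS ->
  exists n, let N := (U :&: lker (lfun_iter f n))%VS in
            let M := (lfun_iter f n @: U)%VS in
  [/\ (N + M = U)%VS, (N :&: M = 0)%VS, (f @: M = M)%VS &
      forall m v, v \in U -> iter m f v = 0 -> v \in N].
Proof.
move=> fU; have [n fM] := limg_lfun_iter_stable fU; exists n => N M.
have NM0 : (N :&: M = 0)%VS.
  apply/eqP; rewrite -subv0; apply/subvP=> v; rewrite !memv_cap memv_ker.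
  case/andP=> /andP[_ /eqP]; rewrite lfun_iterE memv0 => fv0 Mv.
  by rewrite (iter_lfun_inj fM Mv fv0).
split=> //.
  apply/eqP; rewrite eqEdim subv_add capvSl limg_lfun_iter_sub //=.
  by rewrite (dimv_disjoint_sum NM0) limg_ker_dim.
move=> m v Uv fv0; rewrite memv_cap Uv memv_ker /=; apply/eqP.
apply: (iter_lfun_inj (n := m) fM); first exact: memv_img.
by rewrite lfun_iterE -iterD addnC iterD fv0 iter_lfun0.
Qed.

End Fitting.

(** * Right multiplications as derivations; nilpotent subalgebras *)

Section LeibnizAlgebra.
Variables (F : fieldType) (L : leibnizAlgType F).
Implicit Types (x y z b : L) (U V W B E H I J : {vspace L}).

Lemma lbr_der x y z : lbr (lbr x y) z = lbr (lbr x z) y + lbr x (lbr y z).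
Proof. by rewrite lbr_leibniz addrC subrK. Qed.

Lemma limg_rmulP U W b :
  {in U, forall u, lbr u b \in W} -> (rmul b @: U <= W)%VS.
Proof.
move=> UbW; apply/subvP=> _ /memv_imgP[u Uu ->].
by rewrite rmulE UbW.
Qed.

Lemma mem_derived x y : lbr x y \in derived L.
Proof. exact: memv_lprod (memvf x) (memvf y). Qed.

Lemma subalgebraP U :
  subalgebra U <-> {in U &, forall x y, lbr x y \in U}.
Proof. by split=> /lprod_subP. Qed.

Lemma acts_invertiblyP (f : 'End(L)) U :
  acts_invertibly f U <-> (f @: U)%VS = U.
Proof.
split=> [[sfU [g [sgU _ gK]]] | fU].
  apply/eqP; rewrite eqEsubv sfU; apply/subvP=> v Uv.
  by rewrite -{1}[v]gK // memv_img ?(subvP sgU) ?memv_img.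
(* Precomposing with [projv U] turns the surjectivity of [f] from [U] onto [U] into a global map [g]
   with values in [U], right inverse to [f] on [U]. *)
pose p := (f \o projv U)%VF; pose g := (projv U \o p^-1)%VF.
have gU v : g v \in U by rewrite comp_lfunE memv_proj.
have gK : {in U, cancel g f}.
  move=> v Uv; rewrite -[f _]comp_lfunE comp_lfunA comp_lfunE.
  by apply: limg_lfunVK; rewrite limg_comp limg_proj fU.
split; first by rewrite fU.
exists g; split=> //; first by apply/subvP=> _ /memv_imgP[v _ ->].
move=> v Uv; apply/eqP; rewrite -subr_eq0; apply/eqP.
apply: (iter_lfun_inj (n := 1) fU); first by rewrite rpredB.
have fvU : f v \in U by rewrite -fU memv_img.
have -> : iter 1 f (g (f v) - v) = f (g (f v)) - f v by apply: linearB.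
by rewrite gK ?subrr.
Qed.

Lemma abelian_subalgebra U : abelian U -> subalgebra U.
Proof. by move=> abU; apply/subalgebraP=> x y Ux Uy; rewrite abU ?mem0v. Qed.

Lemma abelian_sub U V : (U <= V)%VS -> abelian V -> abelian U.
Proof. by move=> /subvP sUV abV x y /sUV Vx /sUV; apply: abV. Qed.

Lemma abelian_nilpotent U : abelian U -> nilpotent U.
Proof.
move=> abU; exists 2; apply/eqP; rewrite -subv0; apply/lprod_subP=> x y Ux Uy.
by rewrite abU ?mem0v.
Qed.

(** Each application of the derivation [R_x] to [[u, v]] uses up one of the [i + j] steps that kill
    the factors; this induction avoids binomial sums. *)
Lemma iter_rmul_lbr x n : forall i j u v, (i + j <= n)%N ->
    iter i (rmul x) u = 0 -> iter j (rmul x) v = 0 ->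
  iter n (rmul x) (lbr u v) = 0.
Proof.
elim: n => [|n IHn] [|i] [|j] u v // lein u0 v0.
- by rewrite [u]u0 linear0l.
- by rewrite [u]u0 linear0l iter_lfun0.
- by rewrite [u]u0 linear0l iter_lfun0.
- by rewrite [v]v0 linear0r iter_lfun0.
rewrite iterSr rmulE lbr_der iter_lfunD.
rewrite (IHn i j.+1) ?(IHn i.+1 j) ?addr0 //.
- by rewrite -ltnS -addnS.
- by rewrite -rmulE -iterSr.
- by rewrite -rmulE -iterSr.
Qed.

(** [U = <x> + E] is nilpotent: [[U, U]] lies in [E], and since [E] is abelian, elements of [U] act
    on [E] from the right as multiples of [R_x]. So [U^(k+2)] lies in [R_x^k E]. *)
Lemma A_algebra_abelian_add E x :
    A_algebra L -> abelian E -> lbr x x \in E ->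
    {in E, forall e, lbr e x \in E} -> {in E, forall e, lbr x e \in E} ->
    (exists n, {in E, forall e, iter n (rmul x) e = 0}) ->
  abelian (<[x]> + E).
Proof.
move=> AL abE Exx Ex xE [n xn0]; set U := (_ + E)%VS.
have sUU : {in U &, forall u v, lbr u v \in E}.
  move=> _ _ /memv_addP[_ /vlineP[a ->] [d Ed ->]]
    /memv_addP[_ /vlineP[c ->] [e Ee ->]].
  rewrite linearDl !linearDr /= !linearZl_LR !linearZr_LR /=.
  by rewrite [lbr d e]abE // addr0 !rpredD // !rpredZ // ?Ex ?xE.
have sEU : (E <= U)%VS by apply: addvSr.
apply: AL; first by apply/subalgebraP=> u v Uu Uv; apply/(subvP sEU)/sUU.
have fE : (rmul x @: E <= E)%VS by apply: limg_rmulP.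
have Uk k : (lpow U k.+2 <= lfun_iter (rmul x) k @: E)%VS.
  elim: k => [|k IHk]; first by rewrite lim1g; apply/lprod_subP.
  apply/lprod_subP=> _ _ /(subvP IHk)/memv_imgP[d Ed ->]
    /memv_addP[_ /vlineP[c ->] [e Ee ->]].
  rewrite linearDr /= linearZr_LR /= [lbr _ e]abE ?addr0 //.
    by rewrite rpredZ // -rmulE -comp_lfunE memv_img.
  by apply: subvP (limg_lfun_iter_sub k fE) _ _; apply: memv_img.
exists n.+2; apply/eqP; rewrite -subv0; apply: subv_trans (Uk n) _.
by apply/subvP=> _ /memv_imgP[e Ee ->]; rewrite lfun_iterE xn0 ?mem0v.
Qed.

(** * An abelian complement of [L^2] *)

Lemma A_algebra_metabelian_splits : A_algebra L -> metabelian L ->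
  exists2 B : {vspace L}, splits_over_derived B & abelian B.
Proof.
move=> AL mL; set D := derived L.
pose P H := subalgebra H /\ (D + H = fullv)%VS.
have [|H [[saH DH] _ minH]] := @ex_minimal_vspace _ _ P fullv.
  by split; [apply: subvf | apply/eqP; rewrite eqEsubv subvf addvSr].
have HH := (subalgebraP H).1 saH.
have Rnil x : x \in H -> exists n, {in H, forall h, iter n (rmul x) h = 0}.
  move=> Hx; have fH : (rmul x @: H <= H)%VS.
    by apply: limg_rmulP => h Hh; apply: HH.
  have [n /= [NM _ fM Nmax]] := fitting fH; exists n.
  set N := (H :&: _)%VS in NM Nmax; set M := (_ @: H)%VS in NM fM.
  have NH : N = H.
    apply: minH (capvSl _ _); split.
      apply/subalgebraP=> u v; rewrite !memv_cap !memv_ker !lfun_iterE.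
      case/andP=> Hu /eqP u0 /andP[Hv /eqP v0].
      rewrite -lfun_iterE -memv_ker -memv_cap.
      (* The bracket is only known to be killed by [R_x^(2n)]; [Nmax] brings the exponent back to
         [n]. *)
      by apply: (Nmax (n + n)%N); [apply: HH | apply: iter_rmul_lbr u0 v0].
    (* [M = [M, x]] lies in [L^2], so [N] alone already supplements [L^2]. *)
    apply/eqP; rewrite eqEsubv subvf -DH subv_add addvSl -{1}NM /=.
    rewrite subv_add addvSr /= (subv_trans _ (addvSl _ _)) //.
    by rewrite -fM; apply: limg_rmulP => u _; apply: mem_derived.
  by move=> h; rewrite -NH memv_cap memv_ker lfun_iterE => /andP[_ /eqP].
pose E := (H :&: D)%VS.
have HHE : {in H &, forall u v, lbr u v \in E}.
  by move=> u v Hu Hv; rewrite memv_cap HH ?mem_derived.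
have sEH : (E <= H)%VS by apply: capvSl.
have abHE x : x \in H -> abelian (<[x]> + E).
  move=> Hx; apply: A_algebra_abelian_add => //.
  - exact: abelian_sub (capvSr _ _) mL.
  - exact: HHE.
  - by move=> e /(subvP sEH) He; apply: HHE.
  - by move=> e /(subvP sEH) He; apply: HHE.
  - by have [n xn0] := Rnil x Hx; exists n => e /(subvP sEH); apply: xn0.
have abH : abelian H.
  (* [H^3 = 0]: [[H, H]] lies in [E], and [E] brackets to zero with each [x] of [H] inside the
     abelian [<x> + E]. *)
  apply: AL => //; exists 3; apply/eqP; rewrite -subv0.
  apply/lprod_subP=> e x He Hx; rewrite (abHE x Hx) ?mem0v //.
    apply: subvP (addvSr _ _) _ _; apply: subvP He.
    by apply/lprod_subP.
  by rewrite memvE addvSl.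
exists H => //; split=> //.
(* A linear complement of [E] in [H] is a subalgebra as [H] is abelian, and supplements [L^2] as [E]
   lies in [L^2]; minimality makes it all of [H]. *)
have <- : (H :\: E)%VS = H.
  apply: minH (diffvSl _ _); split.
    by apply: abelian_subalgebra; apply: abelian_sub abH; apply: diffvSl.
  apply/eqP; rewrite eqEsubv subvf -DH subv_add addvSl /=.
  rewrite -{1}(addv_diff_cap H E) subv_add addvSr /=.
  apply: subv_trans (addvSl _ _); apply: subv_trans (capvSr _ _) _.
  exact: capvSr.
apply/eqP; rewrite -subv0 -(capv_diff H E); apply/subvP=> v.
rewrite memv_cap => /andP[Dv dv]; rewrite memv_cap dv memv_cap Dv andbT /=.
exact: (subvP (diffvSl H E)).
Qed.

(** * Monolithicity, and Fitting components as ideals *)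

Lemma ideal_of_stable I :
    {in I, forall u x, lbr u x \in I} -> {in I, forall u x, lbr x u \in I} ->
  ideal I.
Proof.
move=> Ir Il; split; apply/lprod_subP=> u v Iu Iv; first exact: Ir.
exact: Il.
Qed.

(** Every nonzero ideal contains a minimal one, which must be the monolith [W0]; two nonzero ideals
    thus share [W0]. *)
Lemma monolithic_disjoint I J : monolithic L -> ideal I -> ideal J ->
  (I :&: J = 0)%VS -> I = 0%VS \/ J = 0%VS.
Proof.
move=> [W0 [_ uniqW]] idI idJ IJ0.
have sub X : ideal X -> X <> 0%VS -> (W0 <= X)%VS /\ W0 <> 0%VS.
  move=> idX X0; pose P (Y : {vspace L}) := ideal Y /\ Y <> 0%VS.
  have [|W [[idW W_0] sWX minW]] := @ex_minimal_vspace _ _ P X; first by [].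
  rewrite (uniqW W) //; split=> // Y idY sYW.
  by have [|Y0] := classic (Y = 0%VS); [left | right; apply: minW].
have [|I0] := classic (I = 0%VS); first by left.
have [|J0] := classic (J = 0%VS); first by right.
have [[sI W0_0] [sJ _]] := (sub I idI I0, sub J idJ J0).
by case: W0_0; apply/eqP; rewrite -subv0 -IJ0 subv_cap sI.
Qed.

(** The correction term [[d, [x, y]]] vanishes, being a bracket of two elements of [L^2]. *)
Lemma metabelian_lbr_rC : metabelian L ->
  {in derived L, forall d x y, lbr (lbr d x) y = lbr (lbr d y) x}.
Proof.
by move=> mL d Dd x y; rewrite lbr_der [lbr d (lbr _ _)]mL ?mem_derived ?addr0.
Qed.

Lemma metabelian_lbr_lC : metabelian L ->
  {in derived L, forall d x y, lbr (lbr x d) y = lbr x (lbr d y)}.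
Proof.
by move=> mL d Dd x y; rewrite lbr_der [lbr (lbr _ _) d]mL ?mem_derived ?add0r.
Qed.

Lemma iter_rmul_lbrr b x n : metabelian L ->
  {in derived L, forall d,
     iter n (rmul b) (lbr d x) = lbr (iter n (rmul b) d) x}.
Proof.
move=> mL; elim: n => //= n IHn d Dd; rewrite IHn // !rmulE.
rewrite metabelian_lbr_rC //; case: n {IHn} => //= n.
by rewrite rmulE mem_derived.
Qed.

Lemma iter_rmul_lbrl b x n : metabelian L ->
  {in derived L, forall d,
     iter n (rmul b) (lbr x d) = lbr x (iter n (rmul b) d)}.
Proof.
move=> mL; elim: n => //= n IHn d Dd; rewrite IHn // !rmulE.
rewrite metabelian_lbr_lC //; case: n {IHn} => //= n.
by rewrite rmulE mem_derived.
Qed.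

Lemma ideal_derived_ker b n : metabelian L ->
  ideal (derived L :&: lker (lfun_iter (rmul b) n)).
Proof.
move=> mL; apply: ideal_of_stable => d; rewrite memv_cap memv_ker lfun_iterE;
  case/andP=> Dd /eqP d0 x; rewrite memv_cap memv_ker lfun_iterE mem_derived /=.
  by rewrite iter_rmul_lbrr // d0 linear0l.
by rewrite iter_rmul_lbrl // d0 linear0r.
Qed.

Lemma ideal_derived_img b n : metabelian L ->
  ideal (lfun_iter (rmul b) n @: derived L).
Proof.
move=> mL; apply: ideal_of_stable => _ /memv_imgP[d Dd ->] x;
  rewrite lfun_iterE.
  by rewrite -iter_rmul_lbrr // -lfun_iterE memv_img ?mem_derived.
by rewrite -iter_rmul_lbrl // -lfun_iterE memv_img ?mem_derived.
Qed.

Lemma rmul_derived_sub b : (rmul b @: derived L <= derived L)%VS.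
Proof. by apply: limg_rmulP => d _; apply: mem_derived. Qed.

Lemma splits_decomp B x : splits_over_derived B ->
  exists d b, [/\ d \in derived L, b \in B & x = d + b].
Proof.
case=> _ DB _; have: x \in (derived L + B)%VS by rewrite DB memvf.
by case/memv_addP=> d Dd [b Bb ->]; exists d, b.
Qed.

(** * Invertible action of the complement on [L^2], and the converse *)

Lemma monolithic_A_rmul_derived B b :
    monolithic L -> A_algebra L -> metabelian L ->
    splits_over_derived B -> abelian B -> b \in B -> b <> 0 ->
  (rmul b @: derived L)%VS = derived L.
Proof.
move=> monoL AL mL spB abB Bb b0.
have [n /= [NM NM0 fM _]] := fitting (rmul_derived_sub b).
have [N0|M0] := monolithic_disjoint monoL (ideal_derived_ker b n mL)
  (ideal_derived_img b n mL) NM0; first by rewrite N0 add0v in NM; rewrite NM in fM.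
rewrite M0 addv0 in NM.
have abU : abelian (<[b]> + derived L).
  apply: A_algebra_abelian_add => //; rewrite ?mem_derived //.
  - by move=> d _; apply: mem_derived.
  - by move=> d _; apply: mem_derived.
  exists n => d; rewrite -NM memv_cap memv_ker lfun_iterE.
  by case/andP=> _ /eqP.
have Ub : b \in (<[b]> + derived L)%VS by rewrite memvE addvSl.
have sDU := subvP (addvSr <[b]> (derived L)).
(* Brackets of [b] with [L^2] vanish by [abU], those with [B] by [abB]. *)
have bC x : lbr x b = 0 /\ lbr b x = 0.
  have [d [b' [/sDU Ud Bb' ->]]] := splits_decomp x spB.
  by rewrite linearDl linearDr /= (abU d b) ?(abU b d) ?(abB b b') ?(abB b' b) ?addr0.
have idb : ideal <[b]>.
  apply: ideal_of_stable => _ /vlineP[c ->] x.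
    by rewrite linearZl_LR /= (bC x).2 scaler0 mem0v.
  by rewrite linearZr_LR /= (bC x).1 scaler0 mem0v.
have idD : ideal (derived L) by apply: ideal_of_stable => u _ x; apply: mem_derived.
have Db0 : (derived L :&: <[b]> = 0)%VS.
  by case: spB => _ _ DB0; apply/eqP; rewrite -subv0 -DB0 capvS.
have [->|/eqP] := monolithic_disjoint monoL idD idb Db0; first by rewrite limg0.
by rewrite -subv0 -memvE memv0 => /eqP.
Qed.

Lemma metabelian_splits_A_algebra B :
    metabelian L -> splits_over_derived B ->
    (forall b, b \in B -> b <> 0 -> (rmul b @: derived L)%VS = derived L) ->
  A_algebra L.
Proof.
move=> mL spB Binv U saU [k Uk].
have [sUD|] := boolP (U <= derived L)%VS; first exact: abelian_sub mL.
case/subvPn=> u; have [d [b [Dd Bb ->]]] := splits_decomp u spB => Uu notD.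
have b0 : b <> 0 by move=> b0; rewrite b0 addr0 Dd in notD.
have Rub v : v \in derived L -> rmul (d + b) v = rmul b v.
  by move=> Dv; rewrite !rmulE linearDr /= mL // add0r.
have fD : (rmul (d + b) @: derived L)%VS = derived L.
  by rewrite -[RHS](Binv b) //; apply: eq_in_limg => v; apply: Rub.
have UU := (subalgebraP U).1 saU.
have UD0 v : v \in U -> v \in derived L -> v = 0.
  (* [R_(d+b)^(k-1)] maps [U] into [U^k = 0], the powers starting at [U^1 = U]; it is injective on
     [L^2]. *)
  move=> Uv Dv; apply: (iter_lfun_inj (n := k.-1) fD Dv).
  apply/eqP; rewrite -memv0 -Uk /lpow.
  by elim: k.-1 => //= n IHn; rewrite rmulE; apply: memv_lprod IHn Uu.
by move=> v w Uv Uw; apply: UD0; [apply: UU | apply: mem_derived].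
Qed.

Lemma strongly_solvable_A_metabelian :
  strongly_solvable L -> A_algebra L -> metabelian L.
Proof.
move=> nilD AL; apply: AL => //; apply/subalgebraP=> x y _ _.
exact: mem_derived.
Qed.

End LeibnizAlgebra.

Theorem theorem5p4 (F : fieldType) (L : leibnizAlgType F) :
  monolithic L ->
  (strongly_solvable L /\ A_algebra L <->
     metabelian L /\
     exists B : {vspace L},
       splits_over_derived B /\
       (forall b : L, b \in B -> b <> 0%R ->
          (rmul b @: derived L)%VS = derived L)) /\
  (metabelian L ->
   forall B : {vspace L}, splits_over_derived B ->
     ((forall b : L, b \in B -> b <> 0%R ->
         (rmul b @: derived L)%VS = derived L) <->
      (forall b : L, b \in B -> b <> 0%R ->
         acts_invertibly (rmul b) (derived L)))).
Proof.
move=> monoL; split; first split.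
- move=> [nilD AL]; have mL := strongly_solvable_A_metabelian nilD AL.
  have [B spB abB] := A_algebra_metabelian_splits AL mL.
  split=> //; exists B; split=> // b Bb b0.
  exact: monolithic_A_rmul_derived Bb b0.
- move=> [mL [B [spB Binv]]]; split; first exact: abelian_nilpotent.
  exact: metabelian_splits_A_algebra Binv.
move=> _ B _; split=> Binv b Bb b0; apply/acts_invertiblyP; exact: Binv.
Qed.
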